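(* Let $T$ be a finite terminal time, $T\ge 0$, let $\mathbf{X}_0\in\mathbb{R}^{n\times d}$, and let $(\mathbf{X}_t)_{t\ge0}$ be the solution of the initial value problem $$\frac{d\mathbf{X}_t}{dt}=-\mathbf{L}\mathbf{X}_t$$ with initial value $\mathbf{X}_0$. For an integer $K\ge1$, let $$\hat{\mathbf{X}}_T^{(K)}=\left(\mathbf{I}-\frac{T}{K}\mathbf{L}\right)^K\mathbf{X}_0$$ be the approximation of $\mathbf{X}_T$ given by the forward Euler method with $K$ steps of size $\Delta t=T/K$. Then the numerical error $\mathbf{e}_T^{(K)}=\mathbf{X}_T-\hat{\mathbf{X}}_T^{(K)}$ satisfies $$\left\Vert\mathbf{e}_T^{(K)}\right\Vert\le\frac{T\Vert\mathbf{L}\Vert\,\Vert\mathbf{X}_0\Vert}{2K}\left(e^{T\Vert\mathbf{L}\Vert}-1\right).$$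
   Context: $\mathcal{G}=(\mathcal{V},\mathbf{A})$ is a finite undirected weighted graph with $n$ nodes, where $\mathbf{A}=(a_{ij})\in\mathbb{R}^{n\times n}$ is its symmetric adjacency matrix with nonnegative edge weights. $\widetilde{\mathbf{A}}=\mathbf{A}+\mathbf{I}$, $\widetilde{\mathbf{D}}$ is the diagonal degree matrix of $\widetilde{\mathbf{A}}$ (its $i$-th diagonal entry is the $i$-th row sum of $\widetilde{\mathbf{A}}$), $\mathbf{S}=\widetilde{\mathbf{D}}^{-1/2}\widetilde{\mathbf{A}}\widetilde{\mathbf{D}}^{-1/2}$, and $\mathbf{L}=\mathbf{I}-\mathbf{S}$ is the symmetrically normalized Laplacian of the augmented graph. For the $n\times n$ matrix $\mathbf{L}$, $\Vert\cdot\Vert$ is the spectral (operator $2$-) norm; for $n\times d$ feature matrices, $\Vert\cdot\Vert$ is the Frobenius norm. *)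

(* Defs.v *)
From mathcomp Require Import all_boot all_order all_algebra.
From mathcomp Require Import all_classical all_reals all_analysis.
Set Implicit Arguments.
Unset Strict Implicit.
Unset Printing Implicit Defensive.
Import Order.TTheory GRing.Theory Num.Theory.
Import numFieldNormedType.Exports.
Local Open Scope classical_set_scope.
Local Open Scope ring_scope.

(* The library's `|M| on matrices is the entrywise maximum, hence the explicit
   norms below; on 'cV[R]_n the Frobenius norm is the Euclidean norm. *)
Definition frobenius_norm (R : realType) (m n : nat) (M : 'M[R]_(m, n)) : R :=
  Num.sqrt (\sum_(i < m) \sum_(j < n) M i j ^+ 2).

(* The set is never empty (it contains 0 even when m or n is 0) and is always
   bounded, so that [sup] is a genuine supremum. *)
Definition spectral_norm (R : realType) (m n : nat) (M : 'M[R]_(m, n)) : R :=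
  sup [set frobenius_norm (M *m x) |
         x in [set x : 'cV[R]_n | frobenius_norm x <= 1]].

Definition aug_adj (R : realType) (n : nat) (A : 'M[R]_n) : 'M[R]_n :=
  A + 1%:M.

Definition aug_deg (R : realType) (n : nat) (A : 'M[R]_n) : 'rV[R]_n :=
  \row_i \sum_(j < n) aug_adj A i j.

Definition aug_deg_mx_inv_sqrt (R : realType) (n : nat) (A : 'M[R]_n) :
    'M[R]_n :=
  diag_mx (\row_i (Num.sqrt (aug_deg A 0 i))^-1).

Definition norm_adj (R : realType) (n : nat) (A : 'M[R]_n) : 'M[R]_n :=
  aug_deg_mx_inv_sqrt A *m aug_adj A *m aug_deg_mx_inv_sqrt A.

Definition norm_laplacian (R : realType) (n : nat) (A : 'M[R]_n) : 'M[R]_n :=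
  1%:M - norm_adj A.

(* X' = - L X on [0, +oo[ with X(0) = X0. The values of X at negative times
   are irrelevant: the derivative at t = 0 is the right derivative. *)
Definition is_ivp_solution (R : realType) (n d : nat) (L : 'M[R]_n)
    (X0 : 'M[R]_(n, d)) (X : R -> 'M[R]_(n, d)) : Prop :=
  [/\ X 0 = X0,
      h^-1 *: (X h - X 0) @[h --> 0^'+] --> - (L *m X 0) &
      forall t : R, 0 < t -> is_derive t 1 X (- (L *m X t))].

Definition euler_approx (R : realType) (n d : nat) (L : 'M[R]_n)
    (X0 : 'M[R]_(n, d)) (T : R) (K : nat) : 'M[R]_(n, d) :=
  (1%:M - (T / K%:R) *: L) ^+ K *m X0.

(* Main.v *)
(** The augmented degrees are positive and the quadratic form of [L] is a
    weighted sum of squares, so [L] is positive semidefinite and the flow does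
    not increase the Frobenius norm. Hence [X'' = L^2 X] has norm at most
    [|L|^2 |X0|], and one Euler step of size [h] commits an error of at most
    [h^2 |L|^2 |X0| / 2]. A step multiplies the previous error by at most
    [1 + h |L|]; summing the geometric series and using
    [(1 + h |L|)^K <= exp (K h |L|)] gives the bound. *)
Require Import Defs.
From mathcomp Require Import all_boot all_order all_algebra.
From mathcomp Require Import all_classical all_reals all_analysis.
From mathcomp Require Import ring lra.
Import Order.TTheory GRing.Theory Num.Theory.
Import numFieldNormedType.Exports.
Local Open Scope classical_set_scope.
Local Open Scope ring_scope.

Set Implicit Arguments.
Unset Strict Implicit.
Unset Printing Implicit Defensive.

(** * The Frobenius inner product and its norm *)

Definition frobenius_dot (R : realType) (m n : nat) (M N : 'M[R]_(m, n)) : R :=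
  \tr (M^T *m N).

Lemma frobenius_dotE (R : realType) (m n : nat) (M N : 'M[R]_(m, n)) :
  frobenius_dot M N = \sum_i \sum_j M i j * N i j.
Proof.
rewrite /frobenius_dot /mxtrace exchange_big /=.
apply: eq_bigr => j _; rewrite mxE; apply: eq_bigr => i _.
by rewrite mxE.
Qed.

Lemma frobenius_dotC (R : realType) (m n : nat) (M N : 'M[R]_(m, n)) :
  frobenius_dot M N = frobenius_dot N M.
Proof. by rewrite /frobenius_dot -mxtrace_tr trmx_mul trmxK. Qed.

Lemma frobenius_dotDr (R : realType) (m n : nat) (M N P : 'M[R]_(m, n)) :
  frobenius_dot M (N + P) = frobenius_dot M N + frobenius_dot M P.
Proof. by rewrite /frobenius_dot mulmxDr mxtraceD. Qed.

Lemma frobenius_dotZr (R : realType) (m n : nat) (a : R) (M N : 'M[R]_(m, n)) :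
  frobenius_dot M (a *: N) = a * frobenius_dot M N.
Proof. by rewrite /frobenius_dot -scalemxAr mxtraceZ. Qed.

Lemma frobenius_dotNr (R : realType) (m n : nat) (M N : 'M[R]_(m, n)) :
  frobenius_dot M (- N) = - frobenius_dot M N.
Proof. by rewrite -scaleN1r frobenius_dotZr mulN1r. Qed.

Lemma frobenius_dot_mulmxr (R : realType) (m n p : nat) (M : 'M[R]_(m, p))
    (L : 'M[R]_(m, n)) (N : 'M[R]_(n, p)) :
  frobenius_dot M (L *m N) = frobenius_dot (L^T *m M) N.
Proof. by rewrite /frobenius_dot trmx_mul trmxK mulmxA. Qed.

Lemma frobenius_dot_ge0 (R : realType) (m n : nat) (M : 'M[R]_(m, n)) :
  0 <= frobenius_dot M M.
Proof.
rewrite frobenius_dotE; apply: sumr_ge0 => i _; apply: sumr_ge0 => j _.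
by rewrite -expr2 sqr_ge0.
Qed.

Lemma frobenius_norm_ge0 (R : realType) (m n : nat) (M : 'M[R]_(m, n)) :
  0 <= frobenius_norm M.
Proof. exact: sqrtr_ge0. Qed.

Lemma frobenius_normK (R : realType) (m n : nat) (M : 'M[R]_(m, n)) :
  frobenius_norm M ^+ 2 = frobenius_dot M M.
Proof.
rewrite frobenius_dotE sqr_sqrtr; last first.
  by apply: sumr_ge0 => i _; apply: sumr_ge0 => j _; exact: sqr_ge0.
by apply: eq_bigr => i _; apply: eq_bigr => j _; rewrite expr2.
Qed.

Lemma frobenius_norm_eq0 (R : realType) (m n : nat) (M : 'M[R]_(m, n)) :
  frobenius_norm M = 0 -> M = 0.
Proof.
move=> M0; have := frobenius_normK M.
rewrite M0 expr0n /= frobenius_dotE => /esym /eqP.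
rewrite psumr_eq0; last first.
  by move=> i _; apply: sumr_ge0 => j _; rewrite -expr2 sqr_ge0.
move=> /allP Mi; apply/matrixP => i j; rewrite mxE.
have /= := Mi i (mem_index_enum i); rewrite psumr_eq0; last first.
  by move=> k _; rewrite -expr2 sqr_ge0.
move=> /allP /(_ j (mem_index_enum j)) /=.
by rewrite mulf_eq0 orbb => /eqP.
Qed.

Lemma frobenius_norm0 (R : realType) (m n : nat) :
  frobenius_norm (0 : 'M[R]_(m, n)) = 0.
Proof.
apply/eqP; rewrite -[_ == 0](@expf_eq0 _ _ 2) frobenius_normK.
by rewrite /frobenius_dot mulmx0 mxtrace0.
Qed.

Lemma frobenius_normZ (R : realType) (m n : nat) (a : R) (M : 'M[R]_(m, n)) :
  frobenius_norm (a *: M) = `|a| * frobenius_norm M.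
Proof.
apply: (@pexpIrn _ 2) => //; rewrite ?nnegrE ?mulr_ge0 ?frobenius_norm_ge0 //.
rewrite exprMn !frobenius_normK frobenius_dotZr frobenius_dotC frobenius_dotZr.
by rewrite real_normK ?num_real // mulrA expr2.
Qed.

Lemma frobenius_normN (R : realType) (m n : nat) (M : 'M[R]_(m, n)) :
  frobenius_norm (- M) = frobenius_norm M.
Proof. by rewrite -scaleN1r frobenius_normZ normrN1 mul1r. Qed.

(** With [a], [b] the two norms, the squared norm of [b *: M - a *: N] expands to
    [2ab (ab - <M, N>)]. It is nonnegative, and [ab] can be divided out once the zero cases are
    removed. *)
Lemma frobenius_cauchy_schwarz (R : realType) (m n : nat)
    (M N : 'M[R]_(m, n)) :
  frobenius_dot M N <= frobenius_norm M * frobenius_norm N.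
Proof.
have [M0|M_neq0] := eqVneq (frobenius_norm M) 0.
  rewrite M0 mul0r (frobenius_norm_eq0 M0) /frobenius_dot trmx0 mul0mx.
  by rewrite mxtrace0.
have [N0|N_neq0] := eqVneq (frobenius_norm N) 0.
  by rewrite N0 mulr0 (frobenius_norm_eq0 N0) /frobenius_dot mulmx0 mxtrace0.
set a := frobenius_norm M; set b := frobenius_norm N.
have a_gt0 : 0 < a by rewrite lt_def M_neq0 frobenius_norm_ge0.
have b_gt0 : 0 < b by rewrite lt_def N_neq0 frobenius_norm_ge0.
have := frobenius_dot_ge0 (b *: M - a *: N).
have -> : frobenius_dot (b *: M - a *: N) (b *: M - a *: N) =
    2 * (a * b) * (a * b - frobenius_dot M N).
  rewrite frobenius_dotDr frobenius_dotNr !frobenius_dotZr.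
  rewrite ![frobenius_dot (_ - _) _]frobenius_dotC !frobenius_dotDr.
  rewrite !frobenius_dotNr !frobenius_dotZr -!frobenius_normK -/a -/b.
  rewrite (frobenius_dotC N M); ring.
by rewrite pmulr_rge0 ?subr_ge0 // !mulr_gt0.
Qed.

Lemma ler_frobenius_normD (R : realType) (m n : nat) (M N : 'M[R]_(m, n)) :
  frobenius_norm (M + N) <= frobenius_norm M + frobenius_norm N.
Proof.
rewrite -(@ler_pXn2r _ 2) ?nnegrE ?addr_ge0 ?frobenius_norm_ge0 //.
have := frobenius_cauchy_schwarz M N.
rewrite sqrrD !frobenius_normK frobenius_dotDr.
rewrite ![frobenius_dot (_ + _) _]frobenius_dotC !frobenius_dotDr.
rewrite (frobenius_dotC N M); lra.
Qed.

(** Choosing [W = M] bounds the squared norm by [c] times the norm. This turns scalar estimates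
    against test matrices into norm estimates, replacing a mean value theorem for matrix-valued
    maps. *)
Lemma frobenius_norm_le_dot (R : realType) (m n : nat) (M : 'M[R]_(m, n))
    (c : R) :
  0 <= c -> (forall W, frobenius_dot W M <= frobenius_norm W * c) ->
  frobenius_norm M <= c.
Proof.
move=> c_ge0 /(_ M) Mc; have [->//|M_neq0] := eqVneq (frobenius_norm M) 0.
rewrite -(@ler_pM2l _ (frobenius_norm M)) -?expr2 ?frobenius_normK //.
by rewrite lt_def M_neq0 frobenius_norm_ge0.
Qed.

Lemma frobenius_normK_col (R : realType) (m n : nat) (M : 'M[R]_(m, n)) :
  frobenius_norm M ^+ 2 = \sum_j frobenius_norm (col j M) ^+ 2.
Proof.
rewrite frobenius_normK frobenius_dotE exchange_big /=.
apply: eq_bigr => j _; rewrite frobenius_normK frobenius_dotE.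
by apply: eq_bigr => i _; rewrite big_ord1 !mxE.
Qed.

(** Each entry of the product is an inner product of a row and a column, so Cauchy-Schwarz applies
    entry by entry. The bound serves to show that the supremum in [spectral_norm] is over a bounded
    set. *)
Lemma frobenius_norm_mulmx (R : realType) (m n p : nat) (M : 'M[R]_(m, n))
    (N : 'M[R]_(n, p)) :
  frobenius_norm (M *m N) <= frobenius_norm M * frobenius_norm N.
Proof.
rewrite -(@ler_pXn2r _ 2) ?nnegrE ?mulr_ge0 ?frobenius_norm_ge0 //.
rewrite frobenius_normK frobenius_dotE exprMn (frobenius_normK_col N).
rewrite frobenius_normK frobenius_dotE mulr_suml; apply: ler_sum => i _.
rewrite mulr_sumr; apply: ler_sum => j _.
have -> : (M *m N) i j = frobenius_dot (row i M)^T (col j N).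
  rewrite frobenius_dotE mxE; apply: eq_bigr => k _.
  by rewrite big_ord1 !mxE.
have -> : \sum_k M i k * M i k = frobenius_norm (row i M)^T ^+ 2.
  rewrite frobenius_normK frobenius_dotE; apply: eq_bigr => k _.
  by rewrite big_ord1 !mxE.
set u := _^T; set v := col j N.
rewrite -expr2 -exprMn -ler_sqrt ?sqr_ge0 // !sqrtr_sqr.
rewrite [leRHS]ger0_norm ?mulr_ge0 ?frobenius_norm_ge0 //.
(* Cauchy-Schwarz is one-sided here; the lower bound comes from applying it to [u] and [- v]. *)
rewrite ler_norml frobenius_cauchy_schwarz andbT lerNl -frobenius_dotNr.
apply: le_trans (frobenius_cauchy_schwarz _ _) _.
by rewrite frobenius_normN.
Qed.

(** * Bounds by the spectral norm *)

Lemma spectral_norm_ubound (R : realType) (m n : nat) (M : 'M[R]_(m, n))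
    (x : 'cV[R]_n) :
  frobenius_norm x <= 1 -> frobenius_norm (M *m x) <= spectral_norm M.
Proof.
move=> x1; apply: ub_le_sup; last by exists x.
exists (frobenius_norm M) => _ [y y1 <-].
apply: le_trans (frobenius_norm_mulmx _ _) _.
by rewrite -[leRHS]mulr1 ler_wpM2l // frobenius_norm_ge0.
Qed.

Lemma spectral_norm_ge0 (R : realType) (m n : nat) (M : 'M[R]_(m, n)) :
  0 <= spectral_norm M.
Proof.
apply: le_trans (frobenius_norm_ge0 _) (@spectral_norm_ubound _ _ _ M 0 _).
by rewrite frobenius_norm0.
Qed.

(** A nonzero [x] is rescaled to the unit sphere, where the supremum applies. *)
Lemma frobenius_norm_mulcV (R : realType) (m n : nat) (M : 'M[R]_(m, n))
    (x : 'cV[R]_n) :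
  frobenius_norm (M *m x) <= spectral_norm M * frobenius_norm x.
Proof.
have [x0|x_neq0] := eqVneq (frobenius_norm x) 0.
  by rewrite x0 mulr0 (frobenius_norm_eq0 x0) mulmx0 frobenius_norm0.
have x_gt0 : 0 < frobenius_norm x by rewrite lt_def x_neq0 frobenius_norm_ge0.
rewrite -ler_pdivrMr // mulrC.
have xV_ge0 : 0 <= (frobenius_norm x)^-1 by rewrite invr_ge0 ltW.
rewrite -[X in X * _ <= _]ger0_norm // -frobenius_normZ scalemxAr.
by apply: spectral_norm_ubound; rewrite frobenius_normZ ger0_norm // mulVf.
Qed.

(** Squared Frobenius norms add up over columns, and the vector bound holds for each column of
    [N]. *)
Lemma frobenius_norm_spectral (R : realType) (m n p : nat) (M : 'M[R]_(m, n))
    (N : 'M[R]_(n, p)) :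
  frobenius_norm (M *m N) <= spectral_norm M * frobenius_norm N.
Proof.
rewrite -(@ler_pXn2r _ 2) ?nnegrE ?mulr_ge0 ?frobenius_norm_ge0 //; last first.
  exact: spectral_norm_ge0.
rewrite exprMn !frobenius_normK_col mulr_sumr; apply: ler_sum => j _.
rewrite colE -mulmxA -colE -exprMn.
rewrite lerXn2r ?nnegrE ?mulr_ge0 ?frobenius_norm_ge0 //.
  exact: spectral_norm_ge0.
exact: frobenius_norm_mulcV.
Qed.

(** * Positive semidefiniteness of the normalized Laplacian *)

(* With y = D^(-1/2) x for a column x of Y, twice the quadratic form of L at x
   is the sum over i, j of (A + I)_ij (y_i - y_j)^2. *)
Lemma norm_laplacian_psd (R : realType) (n d : nat) (A : 'M[R]_n)
    (Y : 'M[R]_(n, d)) :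
  A^T = A -> (forall i j, 0 <= A i j) ->
  0 <= frobenius_dot Y (norm_laplacian A *m Y).
Proof.
move=> A_sym A_ge0; pose B := aug_adj A.
pose s i := (Num.sqrt (aug_deg A 0 i))^-1.
have B_ge0 i j : 0 <= B i j by rewrite !mxE addr_ge0 // ler0n.
have B_sym i j : B j i = B i j.
  by rewrite !mxE -[in LHS]A_sym mxE eq_sym.
have degE i : aug_deg A 0 i = \sum_j B i j by rewrite mxE.
(* The self-loop contributes at least 1 to the degree, so even isolated nodes have an invertible
   degree. *)
have deg_gt0 i : 0 < aug_deg A 0 i.
  rewrite degE (bigD1 i) //= ltr_pwDl ?sumr_ge0 // !mxE eqxx.
  by rewrite ltr_wpDl.
have sK i : s i ^+ 2 * aug_deg A 0 i = 1.
  rewrite exprVn sqr_sqrtr ?ltW // mulVf //; exact: lt0r_neq0.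
have LE i k : (norm_laplacian A *m Y) i k =
    Y i k - \sum_j s i * B i j * s j * Y j k.
  rewrite mulmxBl mul1mx mxE [X in _ + X]mxE mxE; congr (_ - _).
  apply: eq_bigr => j _; congr (_ * _).
  rewrite /norm_adj /aug_deg_mx_inv_sqrt mul_diag_mx mul_mx_diag !mxE.
  by rewrite /s !mxE.
rewrite frobenius_dotE exchange_big /=; apply: sumr_ge0 => k _.
under eq_bigr do rewrite LE.
pose y i := s i * Y i k.
(* Since [s i ^+ 2] inverts the degree, [Y i k ^+ 2] equals [y i ^+ 2] times the degree, which
   spreads the diagonal term over [j] with weights [B i j]. *)
have -> : \sum_i Y i k * (Y i k - \sum_j s i * B i j * s j * Y j k) =
    \sum_i \sum_j B i j * (y i ^+ 2 - y i * y j).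
  apply: eq_bigr => i _.
  under [RHS]eq_bigr do rewrite mulrBr.
  rewrite sumrB -mulr_suml -degE mulrBr; congr (_ - _).
    by rewrite /y exprMn mulrA [_ * s i ^+ 2]mulrC sK mul1r expr2.
  by rewrite mulr_sumr; apply: eq_bigr => j _; rewrite /y; ring.
(* The sum is doubled and [i], [j] are swapped in one copy; symmetry of [B] then completes the
   square. *)
rewrite -(@pmulr_rge0 _ 2) // mulr_natl mulr2n {2}exchange_big /= -big_split /=.
apply: sumr_ge0 => i _; rewrite -big_split /=; apply: sumr_ge0 => j _.
rewrite [B j i]B_sym -mulrDr mulr_ge0 //.
have -> : y i ^+ 2 - y i * y j + (y j ^+ 2 - y j * y i) = (y i - y j) ^+ 2.
  by ring.
exact: sqr_ge0.
Qed.

(** * Monotonicity, and calculus of matrix-valued functions *)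

(** By the mean value theorem on [[a, b]]. Only right continuity is asked at [a], because solutions
    are two-sidedly differentiable only at positive times. *)
Lemma is_derive_nonincreasing (R : realType) (f df : R -> R) (a b : R) :
  a <= b -> f x @[x --> a^'+] --> f a ->
  (forall x, a < x -> is_derive x 1 f (df x)) ->
  (forall x, a < x -> df x <= 0) -> f b <= f a.
Proof.
rewrite le_eqVlt => /predU1P[->//|ab] fa fdf df_le0.
have fc x : a < x -> {for x, continuous f}.
  move=> ax; apply/differentiable_continuous/derivable1_diffP.
  by case: (fdf x ax).
have [c cab] : exists2 c, c \in `]a, b[%R & f b - f a = df c * (b - a).
  apply: MVT => // [x /andP[ax _]|]; first exact: fdf.
  apply/continuous_within_itvP => //; split => // [x|].
    by move=> xab; apply: fc; rewrite (itvP xab).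
  exact/cvg_at_left_filter/fc.
rewrite -subr_le0 => ->; rewrite mulr_le0_ge0 ?subr_ge0 ?(ltW ab) //.
by apply: df_le0; rewrite (itvP cab).
Qed.

Lemma is_derive_entry (R : realType) (m n : nat) (M : R -> 'M[R]_(m, n))
    (dM : 'M[R]_(m, n)) (t : R) (i : 'I_m) (j : 'I_n) :
  is_derive t 1 M dM -> is_derive t 1 (fun u => M u i j) (dM i j).
Proof.
move=> MdM; have [Md dMt] := MdM.
apply: DeriveDef; first by move/derivable_mxP: Md; exact.
by rewrite -dMt derive_mx // mxE.
Qed.

Lemma is_derive_frobenius_dot (R : realType) (m n : nat)
    (M N : R -> 'M[R]_(m, n)) (dM dN : 'M[R]_(m, n)) (t : R) :
  is_derive t 1 M dM -> is_derive t 1 N dN ->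
  is_derive t 1 (fun u => frobenius_dot (M u) (N u))
    (frobenius_dot dM (N t) + frobenius_dot (M t) dN).
Proof.
move=> MdM NdN.
(* Written as a sum of products of scalar functions, the map is covered by the sum and product
   rules. *)
have -> : (fun u => frobenius_dot (M u) (N u)) =
    \sum_i \sum_j ((fun u => M u i j) * (fun u => N u i j)).
  apply/funext => u; rewrite frobenius_dotE fct_sumE; apply: eq_bigr => i _.
  by rewrite fct_sumE.
apply: is_derive_eq.
  apply: is_derive_sum => i; apply: is_derive_sum => j.
  by apply: is_deriveM; exact: is_derive_entry.
rewrite !frobenius_dotE -big_split; apply: eq_bigr => i _.
rewrite -big_split; apply: eq_bigr => j _ /=.
by rewrite /GRing.scale /= addrC [N t i j * _]mulrC.
Qed.

Lemma cvg_frobenius_dot (R : realType) (m n : nat) (F : set_system R)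
    {FF : Filter F} (M N : R -> 'M[R]_(m, n)) (M0 N0 : 'M[R]_(m, n)) :
  M u @[u --> F] --> M0 -> N u @[u --> F] --> N0 ->
  frobenius_dot (M u) (N u) @[u --> F] --> frobenius_dot M0 N0.
Proof.
move=> MM0 NN0.
have entry_cvg (P : R -> 'M[R]_(m, n)) (P0 : 'M[R]_(m, n)) i j :
    P u @[u --> F] --> P0 -> P u i j @[u --> F] --> P0 i j.
  move=> PP0; exact: (cvg_comp _ (fun Q : 'M[R]_(m, n) => Q i j) PP0
    (@coord_continuous _ _ _ i j P0)).
under eq_fun do rewrite frobenius_dotE.
rewrite frobenius_dotE; apply: cvg_big => [|i _]; first exact: add_continuous.
apply: cvg_big => [|j _]; first exact: add_continuous.
by apply: cvgM; exact: entry_cvg.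
Qed.

(** * The flow of [L] and the error of its Euler scheme *)

Section ivp.
Context {R : realType} {n d : nat} (L : 'M[R]_n) (X0 : 'M[R]_(n, d)).
Context (X : R -> 'M[R]_(n, d)) (X_sol : is_ivp_solution L X0 X).
Context (L_psd : forall Y : 'M[R]_(n, d), 0 <= frobenius_dot Y (L *m Y)).

Let l := spectral_norm L.
Let M := frobenius_norm X0.

(** Differentiability settles positive times. At 0, [X h] is [X 0] plus [h] times a difference
    quotient that converges, so the second term vanishes in the limit. *)
Lemma ivp_right_continuous (a : R) : 0 <= a -> X u @[u --> a^'+] --> X a.
Proof.
rewrite le_eqVlt => /predU1P[<-|a_gt0]; last first.
  apply/cvg_at_right_filter/differentiable_continuous/derivable1_diffP.
  by case: X_sol => _ _ /(_ _ a_gt0) [].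
case: X_sol => _ X'0 _.
have : X 0 + h *: (h^-1 *: (X h - X 0)) @[h --> 0^'+] -->
    X 0 + 0 *: - (L *m X 0).
  by apply: cvgD; [exact: cvg_cst|apply: cvgZ X'0; exact: cvg_at_right_filter].
rewrite scale0r addr0; apply: cvg_trans; apply: near_eq_cvg.
by near=> h; rewrite scalerA divff ?scale1r 1?addrC ?subrK //.
Unshelve. all: by end_near. Qed.

Lemma ivp_is_derive (t : R) : 0 < t -> is_derive t 1 X (- (L *m X t)).
Proof. by case: X_sol => _ _; exact. Qed.

Lemma ivp_is_derive_dot (W : 'M[R]_(n, d)) (t : R) : 0 < t ->
  is_derive t 1 (fun u => frobenius_dot W (X u)) (- frobenius_dot W (L *m X t)).
Proof.
move=> t_gt0; apply: is_derive_eq.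
  by apply: is_derive_frobenius_dot (ivp_is_derive t_gt0); exact: is_derive_cst.
by rewrite /frobenius_dot trmx0 mul0mx mxtrace0 add0r mulmxN raddfN.
Qed.

(** The squared norm has derivative [- 2 <X, L X>], which [L_psd] makes nonpositive. *)
Lemma ivp_norm_le (t : R) : 0 <= t -> frobenius_norm (X t) <= M.
Proof.
move=> t_ge0; rewrite -(@ler_pXn2r _ 2) ?nnegrE ?frobenius_norm_ge0 //.
rewrite !frobenius_normK; have [<- _ _] := X_sol.
apply: (@is_derive_nonincreasing _ (fun u => frobenius_dot (X u) (X u))
  (fun u => - (2 * frobenius_dot (X u) (L *m X u))) 0 t) => // [|u u_gt0|u _].
- by apply: cvg_frobenius_dot; exact: ivp_right_continuous.
- apply: is_derive_eq.
    by apply: is_derive_frobenius_dot; exact: ivp_is_derive.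
  by rewrite frobenius_dotC !frobenius_dotNr mulr_natl mulr2n opprD.
- by rewrite oppr_le0 mulr_ge0.
Qed.

(** This bounds the growth of the first derivative of [<W, X>]: the second derivative is
    [<W, L (L X)>], at most [c] by Cauchy-Schwarz, two spectral bounds and [ivp_norm_le]. *)
Lemma ivp_dot_derivative_lipschitz (W : 'M[R]_(n, d)) (a b : R) :
  0 <= a -> a <= b ->
  frobenius_dot W (L *m X a) - frobenius_dot W (L *m X b) <=
  frobenius_norm W * (l ^+ 2 * M) * (b - a).
Proof.
move=> a_ge0 ab; set c := frobenius_norm W * _.
(* Moving [L] onto the test matrix as [L^T *m W] lets the equation be differentiated once more
   against a fixed matrix. *)
pose f u : R := - frobenius_dot (L^T *m W) (X u) - c * u.
suff : f b <= f a by rewrite /f -!frobenius_dot_mulmxr; lra.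
apply: (@is_derive_nonincreasing _ f
  (fun u => frobenius_dot W (L *m (L *m X u)) - c)) => // [|u au|u au].
- apply: cvgB; last by apply: cvgM; [exact: cvg_cst|exact: cvg_at_right_filter].
  apply: cvgN; apply: cvg_frobenius_dot; first exact: cvg_cst.
  exact: ivp_right_continuous.
- have -> : f = - (fun u => frobenius_dot (L^T *m W) (X u)) - c \*: id by [].
  have fd := ivp_is_derive_dot (L^T *m W) (le_lt_trans a_ge0 au).
  apply: is_derive_eq.
  by rewrite opprK -frobenius_dot_mulmxr /GRing.scale /= mulr1.
- rewrite subr_le0; apply: le_trans (frobenius_cauchy_schwarz _ _) _.
  rewrite ler_wpM2l ?frobenius_norm_ge0 //.
  apply: le_trans (frobenius_norm_spectral _ _) _.
  rewrite expr2 -mulrA ler_wpM2l ?spectral_norm_ge0 //.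
  apply: le_trans (frobenius_norm_spectral _ _) _.
  rewrite ler_wpM2l ?spectral_norm_ge0 // ivp_norm_le //.
  exact/ltW/(le_lt_trans a_ge0).
Qed.

(* Taylor's estimate is tested against an arbitrary [W], which reduces it to
   the monotonicity of a scalar function. *)
Lemma ivp_euler_local_error (a h : R) : 0 <= a -> 0 <= h ->
  frobenius_norm (X (a + h) - (X a - h *: (L *m X a))) <=
  h ^+ 2 / 2 * (l ^+ 2 * M).
Proof.
move=> a_ge0 h_ge0; apply: frobenius_norm_le_dot => [|W].
  apply: mulr_ge0; first by rewrite divr_ge0 ?sqr_ge0.
  by apply: mulr_ge0; rewrite ?sqr_ge0 ?frobenius_norm_ge0.
set c := frobenius_norm W * (l ^+ 2 * M).
pose D := frobenius_dot W (L *m X a).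
(* Up to a constant, [f] is the first-order Taylor remainder at [a] minus its claimed quadratic
   bound. Its derivative is nonpositive by the preceding Lipschitz estimate. *)
pose f u : R := frobenius_dot W (X u) + D * (u - a) - c / 2 * (u - a) ^+ 2.
suff : f (a + h) <= f a.
  rewrite frobenius_dotDr frobenius_dotNr frobenius_dotDr frobenius_dotNr.
  rewrite frobenius_dotZr /f -/D subrr expr0n /= (addrC a) addrK !mulr0.
  by rewrite /c; lra.
apply: (@is_derive_nonincreasing _ f
  (fun u => D - frobenius_dot W (L *m X u) - c * (u - a)))
  => // [||u au|u au].
- by rewrite lerDl.
- have idB : u - a @[u --> a^'+] --> a - a.
    by apply: cvgB; [exact: cvg_at_right_filter|exact: cvg_cst].
  apply: cvgB; last first.
    by apply: cvgM; [exact: cvg_cst|apply: cvgM].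
  apply: cvgD; last by apply: cvgM; [exact: cvg_cst|].
  by apply: cvg_frobenius_dot; [exact: cvg_cst|exact: ivp_right_continuous].
- have -> : f = (fun u => frobenius_dot W (X u)) + D \*: (id - cst a)
      - (c / 2) \*: (id - cst a) ^+ 2.
    by apply/funext => v; rewrite /f /= !fctE.
  have fd := ivp_is_derive_dot W (le_lt_trans a_ge0 au).
  apply: is_derive_eq.
  by rewrite /GRing.scale /= !fctE; field.
- by rewrite subr_le0; apply: ivp_dot_derivative_lipschitz => //; exact: ltW.
Qed.

Lemma ivp_euler_error (h : R) (k : nat) : 0 <= h ->
  frobenius_norm (X (h * k%:R) - (1%:M - h *: L) ^+ k *m X0) <=
  h * l / 2 * M * ((1 + h * l) ^+ k - 1).
Proof.
move=> h_ge0; elim: k => [|k IHk].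
  rewrite mulr0 !expr0 mul1mx; have [-> _ _] := X_sol.
  by rewrite !subrr frobenius_norm0 mulr0.
set x := X (h * k%:R) in IHk *; set E := _ ^+ k *m X0 in IHk.
(* The new error is the local error of a step started on the exact solution, plus the old error
   [x - E] propagated by [1 - h L]. *)
have -> : X (h * k.+1%:R) - (1%:M - h *: L) ^+ k.+1 *m X0 =
    (X (h * k%:R + h) - (x - h *: (L *m x))) + (x - E) - h *: (L *m (x - E)).
  rewrite exprS -mulmxA -/E mulmxBl mul1mx -scalemxAl -natr1 mulrDr mulr1.
  rewrite mulmxBr scalerBr; apply/matrixP => i j; rewrite !mxE; ring.
apply: le_trans (ler_frobenius_normD _ _) _.
apply: le_trans (lerD (ler_frobenius_normD _ _) (lexx _)) _.
rewrite frobenius_normN frobenius_normZ ger0_norm //.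
have hk_ge0 : 0 <= h * k%:R by rewrite mulr_ge0.
have loc := ivp_euler_local_error hk_ge0 h_ge0.
have LE := ler_wpM2l h_ge0 (frobenius_norm_spectral L (x - E)).
have l_ge0 : 0 <= 1 + h * l.
  by rewrite addr_ge0 // mulr_ge0 // spectral_norm_ge0.
(* The bound is the exact solution of the recursion [e' = (1 + h l) e + h^2 l^2 M / 2] starting at
   0, so the estimates combine linearly. *)
have := ler_wpM2l l_ge0 IHk; rewrite [(1 + h * l) ^+ k.+1]exprS.
move: loc LE; rewrite -/x -/l -/M; lra.
Qed.

End ivp.

Theorem theorem2 (R : realType) (n d : nat) (A : 'M[R]_n)
    (A_sym : A^T = A) (A_ge0 : forall i j : 'I_n, 0 <= A i j)
    (T : R) (T_ge0 : 0 <= T)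
    (X0 : 'M[R]_(n, d)) (X : R -> 'M[R]_(n, d))
    (X_sol : is_ivp_solution (norm_laplacian A) X0 X)
    (K : nat) (K_ge1 : (1 <= K)%N) :
  frobenius_norm (X T - euler_approx (norm_laplacian A) X0 T K)
  <= T * spectral_norm (norm_laplacian A) * frobenius_norm X0 / (2 * K%:R)
     * (expR (T * spectral_norm (norm_laplacian A)) - 1).
Proof.
have L_psd Y := @norm_laplacian_psd R n d A Y A_sym A_ge0.
set l := spectral_norm _; set M := frobenius_norm X0.
have l_ge0 : 0 <= l by exact: spectral_norm_ge0.
have K_neq0 : K%:R != 0 :> R by rewrite pnatr_eq0 -lt0n.
have h_ge0 : 0 <= T / K%:R by rewrite divr_ge0.
have := ivp_euler_error X_sol L_psd K h_ge0.
rewrite divfK // -/l -/M => /le_trans; apply.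
have -> : T * l * M / (2 * K%:R) = T / K%:R * l / 2 * M by field.
rewrite ler_wpM2l ?mulr_ge0 ?invr_ge0 ?frobenius_norm_ge0 // lerB //.
(* This makes [expR (T * l)] the [K]-th power of [expR (T / K * l)], so that [1 + x <= expR x] can
   be raised to the power [K]. *)
have -> : T * l = T / K%:R * l * K%:R by field.
rewrite expRM_natr lerXn2r ?nnegrE ?expR_ge0 ?expR_ge1Dx //.
by rewrite addr_ge0 // mulr_ge0.
Qed.
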